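(* For all Dyck paths $\delta$, the modified Dyck path Macdonald function $\Phi_\delta(x_1,x_2,x_3,\dots)$ is a quasi-symmetric function.
   Context: **Dyck graph.** A Dyck path $\delta$ of length $n$ is a lattice path from $(0,0)$ to $(n,n)$ with unit north and east steps staying weakly above $y=x$. $G_\delta$ is the graph on $[n]$ with $i<j$ adjacent iff $(i-1,j)$ is on or below $\delta$. **Dyck path statistics.** Let $\delta$ be a Dyck path of length $n$ with exactly $k$ initial north steps. The column graph $C_\delta$ is the directed graph on $[n]$ with an edge $j\to i$ whenever $i<j$ and $i$ is the largest number less than $j$ with $\{i,j\}$ not an edge of $G_\delta$; then write $d(j)=i$. (So $d(j)$ is defined exactly for $j\ge k+1$.) For $i\ge k+1$, $l(i)$ is the number of $j>i$ having a directed path to $i$ in $C_\delta$. The connected components of $C_\delta$ are the columns, and $\mathrm{ht}(i)$ is the size of the column containing $i$. The bounce path $b_\delta$ starts at $(0,0)$ and successively goes north as far as possible without leaving the region on or below $\delta$, then east to the diagonal, and repeats; it partitions $[n]$ into consecutive intervals (rows) $R_1,\dots,R_r$, the maximal cliques of the Dyck graph of $b_\delta$. $\mathrm{arm}(i)$ is the set of $1\le j<i$ such that either $i,j$ are in the same row and $\mathrm{ht}(j)\le\mathrm{ht}(i)$, or $i,j$ are adjacent in $G_\delta$, not in the same row, and $\mathrm{ht}(j)<\mathrm{ht}(i)$; $a(i)=|\mathrm{arm}(i)|$. For an arbitrary map $f:[n]\to\mathbb{N}=\{1,2,\dots\}$: $\mathrm{Des}(f)=\{j\ge k+1:f(j)>f(d(j))\}$;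 $\mathrm{Inv}(f)$ is the set of pairs $i<j$ adjacent in $G_\delta$ with $f(i)<f(j)$; $\mathrm{maj}(f)=\sum_{i\in\mathrm{Des}(f)}(l(i)+1)$; $\mathrm{inv}^*(f)=|\mathrm{Inv}(f)|-\sum_{i\in\mathrm{Des}(f)}a(i)$. **Modified Dyck path Macdonald function.** $\Phi_\delta=\sum_{f:[n]\to\mathbb{N}}q^{\mathrm{maj}(f)}t^{\mathrm{inv}^*(f)}x^f$, the sum over all (not necessarily proper) colorings, with $x^f=\prod_{i=1}^nx_{f(i)}$; its coefficients lie in $\mathbb{Z}[q,t^{\pm1}]$. **Quasi-symmetric.** A formal power series $g(x_1,x_2,\dots)$ is quasi-symmetric if for all exponents $\alpha_1,\dots,\alpha_k$ (positive integers) and all $i_1<\dots<i_k$, the coefficient of $x_{i_1}^{\alpha_1}\cdots x_{i_k}^{\alpha_k}$ in $g$ equals the coefficient of $x_1^{\alpha_1}\cdots x_k^{\alpha_k}$. *)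

(* Defs.v *)
From mathcomp Require Import all_boot all_order all_algebra fraction finmap.
From mathcomp Require Import monalg.
From mathcomp Require Import boolp classical_sets cardinality fsbigop.

Set Implicit Arguments.
Unset Strict Implicit.
Unset Printing Implicit Defensive.

Import GRing.Theory.

Local Open Scope ring_scope.

(* Conventions: the vertex i of [n] = {1, .., n} is the element i-1 of 'I_n,  *)
(* and the colour (or variable index) c in {1, 2, ..} is the natural number   *)
(* c-1. A lattice path starting at (0, 0) is the sequence of its steps, where *)
(* true is a unit north step and false a unit east step.                      *)

(* Coordinates of the lattice point reached after m steps. *)
Definition xcoord (w : seq bool) (m : nat) : nat := count_mem false (take m w).
Definition ycoord (w : seq bool) (m : nat) : nat := count_mem true (take m w).

Definition is_dyck (n : nat) (w : seq bool) : bool :=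
  [&& xcoord w (size w) == n, ycoord w (size w) == n &
      [forall m : 'I_(size w).+1, (xcoord w m <= ycoord w m)%N]].

Record dyck_path (n : nat) := DyckPath {
  steps :> seq bool;
  steps_dyck : is_dyck n steps
}.

Definition on_or_below (w : seq bool) (a b : nat) : bool :=
  [exists m : 'I_(size w).+1, (xcoord w m == a) && (b <= ycoord w m)%N].

(* With vertices shifted down by one, i < j are adjacent iff (i, j+1) is on   *)
(* or below the path.                                                         *)
Definition dyck_adj (n : nat) (w : seq bool) : rel 'I_n :=
  fun i j => ((i < j)%N && on_or_below w i j.+1)
          || ((j < i)%N && on_or_below w j i.+1).

Definition initial_norths (w : seq bool) : nat := index false w.

(* The height reached by going north from (p, p) as far as possible without   *)
(* leaving the region on or below the path.                                   *)
Definition top (n : nat) (w : seq bool) (p : nat) : nat :=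
  \max_(y < n.+1 | on_or_below w p y) y.

(* The part of the bounce path that starts at (p, p). Every bounce advances   *)
(* by at least one, so n is enough fuel to reach (n, n).                      *)
Fixpoint bounce_from (fuel n : nat) (w : seq bool) (p : nat) : seq bool :=
  if fuel is fuel'.+1 then
    if (p < n)%N then
      let h := top n w p in
      nseq (h - p) true ++ nseq (h - p) false ++ bounce_from fuel' n w h
    else [::]
  else [::].

Definition bounce_path (n : nat) (w : seq bool) : seq bool :=
  bounce_from n n w 0.

Definition clique (T : finType) (e : rel T) (A : {set T}) : bool :=
  [forall i in A, forall j in A, (i != j) ==> e i j].

Definition rows (n : nat) (w : seq bool) : {set {set 'I_n}} :=
  [set R | maxset (clique (@dyck_adj n (bounce_path n w))) R].

Definition same_row (n : nat) (w : seq bool) : rel 'I_n :=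
  fun i j => [exists R in @rows n w, (i \in R) && (j \in R)].

(* The directed edge j -> i of the column graph, i.e., d(j) = i. *)
Definition column_edge (n : nat) (w : seq bool) : rel 'I_n :=
  fun j i => [&& (i < j)%N, ~~ dyck_adj w i j &
    [forall i' : 'I_n, (i < i' < j)%N ==> dyck_adj w i' j]].

Definition dfun (n : nat) (w : seq bool) (j : 'I_n) : option 'I_n :=
  [pick i | column_edge w j i].

Definition l_stat (n : nat) (w : seq bool) (i : 'I_n) : nat :=
  #|[set j : 'I_n | (i < j)%N && connect (@column_edge n w) j i]|.

Definition column (n : nat) (w : seq bool) (i : 'I_n) : {set 'I_n} :=
  [set j | connect (fun u v : 'I_n => column_edge w u v || column_edge w v u)
                   i j].

Definition ht (n : nat) (w : seq bool) (i : 'I_n) : nat := #|column w i|.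

Definition arm (n : nat) (w : seq bool) (i : 'I_n) : {set 'I_n} :=
  [set j : 'I_n | (j < i)%N &&
     ((same_row w i j && (ht w j <= ht w i)%N)
      || [&& dyck_adj w i j, ~~ same_row w i j & (ht w j < ht w i)%N])].

Definition a_stat (n : nat) (w : seq bool) (i : 'I_n) : nat := #|arm w i|.

Notation coloring n := {ffun 'I_n -> nat}.

Definition Des (n : nat) (w : seq bool) (f : coloring n) : {set 'I_n} :=
  [set j : 'I_n | (initial_norths w <= j)%N &&
     (if dfun w j is Some i then (f i < f j)%N else false)].

Definition Inv (n : nat) (w : seq bool) (f : coloring n) :
    {set 'I_n * 'I_n} :=
  [set p : 'I_n * 'I_n |
     [&& (p.1 < p.2)%N, dyck_adj w p.1 p.2 & (f p.1 < f p.2)%N]].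

Definition maj (n : nat) (w : seq bool) (f : coloring n) : nat :=
  (\sum_(i in Des w f) (l_stat w i + 1))%N.

Definition inv_star (n : nat) (w : seq bool) (f : coloring n) : int :=
  #|Inv w f|%:Z - \sum_(i in Des w f) (a_stat w i)%:Z.

(* The ring Z[q, t^{+-1}] is taken inside its field of fractions: q is the    *)
(* inner variable of Z[q][t] and t the outer one.                             *)
Notation Qqt := {fraction {poly {poly int}}}.
Definition q : Qqt := tofrac ('X%:P : {poly {poly int}}).
Definition t : Qqt := tofrac ('X : {poly {poly int}}).

(* A formal power series in x_1, x_2, .. maps each monomial to its            *)
(* coefficient.                                                               *)
Definition power_series (R : Type) : Type := {cmonom nat} -> R.

Definition xmon (n : nat) (f : coloring n) : {cmonom nat} :=
  \big[mmul/mone]_(i < n) ucm (f i).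

Definition Phi (n : nat) (delta : dyck_path n) : power_series Qqt :=
  fun m => \sum_(f \in [set f : coloring n | xmon f = m]%classic)
             (q ^+ maj delta f * t ^ inv_star delta f).

(* x_(i_1)^(a_1) .. x_(i_k)^(a_k) *)
Definition power_mon (k : nat) (i a : 'I_k -> nat) : {cmonom nat} :=
  \big[mmul/mone]_(j < k) expcmn (ucm (i j)) (a j).

Definition quasi_symmetric (R : Type) (g : power_series R) : Prop :=
  forall (k : nat) (a i : 'I_k -> nat),
    (forall j, (0 < a j)%N) ->
    (forall j1 j2 : 'I_k, (j1 < j2)%N -> (i j1 < i j2)%N) ->
    g (power_mon i a) = g (power_mon (@nat_of_ord k) a).

(* The sum defining each coefficient of Phi is finite (a sum over an infinite *)
(* support would be 0 by convention).                                         *)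
Lemma xmonE (n : nat) (f : coloring n) (c : nat) :
  xmon f c = #|[set i | f i == c]|.
Proof.
have -> : xmon f c = (\sum_(i < n) (f i == c))%N.
  rewrite /xmon (big_morph (fun m : {cmonom nat} => m c)
    (fun m1 m2 => cmM c m1 m2) (cm1 c)).
  by apply: eq_bigr => i _; exact: cmU.
by rewrite -sum1dep_card [RHS]big_mkcond; apply: eq_bigr => i _; case: eqP.
Qed.

Lemma xmon_fiber_finite (n : nat) (m : {cmonom nat}) :
  finite_set [set f : coloring n | xmon f = m]%classic.
Proof.
pose N := (\max_(c <- finsupp m) c)%N.
apply: (@sub_finite_set _ _
  [set [ffun i => nat_of_ord (g i)] | g in [set: {ffun 'I_n -> 'I_N.+1}]]%classic).
  move=> f /= fm; have leN i : (f i < N.+1)%N.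
    rewrite ltnS /N (bigD1_seq (f i)) ?fset_uniq ?leq_maxl //=.
    rewrite mem_finsupp -fm xmonE -lt0n card_gt0.
    by apply/set0Pn; exists i; rewrite inE.
  exists [ffun i => Ordinal (leN i)] => //.
  by apply/ffunP=> i; rewrite !ffunE.
exact/finite_image/finite_finset.
Qed.

(* Main.v *)
From mathcomp Require Import all_boot all_algebra finmap monalg.
From mathcomp Require Import boolp classical_sets functions cardinality fsbigop.
Require Import Defs.

(** The statistics maj and inv^* only see comparisons between colours, so they
    are unchanged when the colours are relabelled by an increasing map. The
    coefficient of x_(i_1)^(a_1) .. x_(i_k)^(a_k) is a sum over the maps
    h : [n] -> [k] with fibres of sizes a_1, .., a_k, composed with the
    increasing map i, and hence does not depend on i. *)

Set Implicit Arguments.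
Unset Strict Implicit.
Unset Printing Implicit Defensive.

Import GRing.Theory.

Local Open Scope ring_scope.

Section OrderInvariance.

Variables (n : nat) (w : seq bool) (f g : coloring n).
Hypothesis fg_lt : forall x y, (f x < f y)%N = (g x < g y)%N.

Lemma eq_Des : Des w f = Des w g.
Proof. by apply/setP=> y; rewrite !inE; case: dfun => // x; rewrite fg_lt. Qed.

Lemma eq_Inv : Inv w f = Inv w g.
Proof. by apply/setP=> p; rewrite !inE fg_lt. Qed.

Lemma eq_maj : maj w f = maj w g.
Proof. by rewrite /maj eq_Des. Qed.

Lemma eq_inv_star : inv_star w f = inv_star w g.
Proof. by rewrite /inv_star eq_Des eq_Inv. Qed.

End OrderInvariance.

Lemma expcmnE (m : {cmonom nat}) (e c : nat) : expcmn m e c = (e * m c)%N.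
Proof.
(* [expcmn] is an [iterop], whose value at exponent one is [m] itself rather than [m] times [mone];
   the induction therefore starts at one. *)
case: e => [|e]; first exact: cm1.
rewrite /expcmn iteropS; elim: e => [|e IHe]; first by rewrite mul1n.
by rewrite iterS mulSn -IHe; apply: cmM.
Qed.

(** Evaluation at [c] is a morphism from monomials under product to numbers under addition. *)
Lemma power_monE (k : nat) (i a : 'I_k -> nat) (c : nat) :
  power_mon i a c = (\sum_(j < k | i j == c) a j)%N.
Proof.
rewrite /power_mon (big_morph (fun m : {cmonom nat} => m c)
  (fun m1 m2 => cmM c m1 m2) (cm1 c)) [RHS]big_mkcond.
apply: eq_bigr => j _; rewrite expcmnE cmU.
by case: eqP => _; rewrite ?muln1 ?muln0.
Qed.

Definition relabel (n k : nat) (i : 'I_k -> nat) (h : {ffun 'I_n -> 'I_k}) :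
  coloring n := [ffun x => i (h x)].

Definition content (n k : nat) (a : 'I_k -> nat) : set {ffun 'I_n -> 'I_k} :=
  [set h | forall j, #|[set x | h x == j]%SET| = a j]%classic.

Section Relabel.

Variables (n k : nat) (i a : 'I_k -> nat).
Hypothesis i_inj : injective i.

Lemma power_mon_inj (j : 'I_k) : power_mon i a (i j) = a j.
Proof.
by rewrite power_monE (eq_bigl (pred1 j)) ?big_pred1_eq // => j'; apply: inj_eq.
Qed.

Lemma xmon_relabel (h : {ffun 'I_n -> 'I_k}) (j : 'I_k) :
  xmon (relabel i h) (i j) = #|[set x | h x == j]|.
Proof.
rewrite xmonE; congr #|pred_of_set _|.
by apply/setP=> x; rewrite !inE ffunE inj_eq.
Qed.

Lemma relabel_bij :
  set_bij (content a)
    [set f : coloring n | xmon f = power_mon i a]%classic (relabel i).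
Proof.
split.
- move=> h hP /=; apply/eqP/cmP => c.
  (* On a colour outside the range of [i], both exponents vanish. *)
  have [[j <-]|no_j] := pselect (exists j, i j = c).
    by rewrite xmon_relabel power_mon_inj hP.
  rewrite xmonE power_monE big1 => [|j /eqP jc]; last by case: no_j; exists j.
  apply/eqP; rewrite cards_eq0; apply/eqP/setP=> x; rewrite !inE ffunE.
  by apply/negbTE/eqP => hx; case: no_j; exists (h x).
- move=> h1 h2 _ _ /ffunP eq12; apply/ffunP=> x; apply: i_inj.
  by have := eq12 x; rewrite !ffunE.
- move=> f /= fP.
  (* A colour used by [f] has positive exponent in [power_mon i a], so it lies in the range of [i];
     [cid] selects an index, which makes [h] definable as a function. *)
  have colour x : {j | f x = i j}.
    apply: cid; apply: contrapT => no_j.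
    have : (0 < xmon f (f x))%N.
      by rewrite xmonE card_gt0; apply/set0Pn; exists x; rewrite inE.
    by rewrite fP power_monE big1 // => j /eqP jx; case: no_j; exists j.
  pose h := [ffun x => sval (colour x)].
  have hE : relabel i h = f.
    by apply/ffunP=> x; rewrite !ffunE -(svalP (colour x)).
  by exists h => // j; rewrite -xmon_relabel hE fP power_mon_inj.
Qed.

End Relabel.

(** Reindexing along [relabel i] leaves [i] only inside the statistics, where the inclusion
    [nat_of_ord] may replace it because both induce the same order on the colours of the
    vertices. *)
Lemma Phi_power_mon (n k : nat) (delta : dyck_path n) (i a : 'I_k -> nat) :
  (forall j1 j2 : 'I_k, (j1 < j2)%N -> (i j1 < i j2)%N) ->
  Phi delta (power_mon i a) =
  \sum_(h \in content a)
    (q ^+ maj delta (relabel (@nat_of_ord k) h : coloring n)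
     * t ^ inv_star delta (relabel (@nat_of_ord k) h)).
Proof.
move=> i_homo.
have i_mono j1 j2 : (i j1 < i j2)%N = (j1 < j2)%N.
  case: (ltngtP j1 j2) => [/i_homo // | /i_homo/ltnW | /ord_inj ->].
    by rewrite ltnNge => ->.
  by rewrite ltnn.
have i_inj : injective i.
  move=> j1 j2 eq12; apply/ord_inj.
  by case: (ltngtP j1 j2); rewrite // -i_mono eq12 ltnn.
rewrite /Phi (reindex_fsbig _ _ _ _ (relabel_bij n a i_inj)).
apply: eq_fsbigr => h _.
have lt_relabel x y : (relabel i h x < relabel i h y)%N =
    (relabel (@nat_of_ord k) h x < relabel (@nat_of_ord k) h y)%N.
  by rewrite !ffunE i_mono.
by rewrite (eq_maj _ lt_relabel) (eq_inv_star _ lt_relabel).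
Qed.

Theorem proposition6p7 (n : nat) (delta : dyck_path n) :
  quasi_symmetric (Phi delta).
(* The inclusion [nat_of_ord] is itself increasing, so both coefficients equal the same sum over
   [content a]. *)
Proof. by move=> k a i _ i_homo; rewrite !Phi_power_mon. Qed.
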